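(* Let $S$ be a $\Gamma$-hemiring with left unity and right unity, and let $L$ be its left operator hemiring. Then the lattice $\mathrm{Fh\text{-}I}(S)$ of all fuzzy $h$-ideals of $S$ and the lattice $\mathrm{Fh\text{-}I}(L)$ of all fuzzy $h$-ideals of $L$ are isomorphic via the mapping $\sigma\mapsto\sigma^{+'}$, where $\sigma\in\mathrm{Fh\text{-}I}(S)$ and $\sigma^{+'}\in\mathrm{Fh\text{-}I}(L)$.
   Context: **$\Gamma$-hemiring.** Let $S,\Gamma$ be additive commutative semigroups with zero. $S$ is a $\Gamma$-hemiring if there is a map $S\times\Gamma\times S\to S$, $(a,\alpha,b)\mapsto a\alpha b$, such that for all $a,b,c\in S$, $\alpha,\beta\in\Gamma$: $(a+b)\alpha c=a\alpha c+b\alpha c$; $a\alpha(b+c)=a\alpha b+a\alpha c$; $a(\alpha+\beta)b=a\alpha b+a\beta b$; $a\alpha(b\beta c)=(a\alpha b)\beta c$; $0_S\alpha a=0_S=a\alpha 0_S$; $a0_\Gamma b=0_S=b0_\Gamma a$. **Hemiring.** A set $H$ with operations $+,\cdot$ such that $(H,+)$ is a commutative monoid with identity $0$, $(H,\cdot)$ is a semigroup, multiplication distributes over addition from either side, and $0s=0=s0$ for all $s$. **Left operator hemiring $L$.** Let $F$ be the free additive commutative semigroup generated by $S\times\Gamma$; define the congruence $\rho$ on $F$ by $\sum_{i=1}^m(x_i,\alpha_i)\,\rho\,\sum_{j=1}^n(y_j,\beta_j)$ iff $\sum_i x_i\alpha_i a=\sum_j y_j\beta_j a$ for all $a\in S$.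 The class of $\sum_i(x_i,\alpha_i)$ is written $\sum_i[x_i,\alpha_i]$. $L=F/\rho$ with multiplication $(\sum_i[x_i,\alpha_i])(\sum_j[y_j,\beta_j])=\sum_{i,j}[x_i\alpha_iy_j,\beta_j]$ is a hemiring; its zero is $[0_S,\gamma]$ (any $\gamma\in\Gamma$). **Unities.** $S$ has a left unity if there are finitely many $e_i\in S,\delta_i\in\Gamma$ with $\sum_i e_i\delta_i a=a$ for all $a\in S$; it has a right unity if there are finitely many $\gamma_j\in\Gamma,f_j\in S$ with $\sum_j a\gamma_jf_j=a$ for all $a\in S$. **Fuzzy $h$-ideals.** A fuzzy subset of a set $X$ is a function $X\to[0,1]$; it is non-empty if it is not identically $0$. A non-empty fuzzy subset $\mu$ of $S$ is a fuzzy left (right) ideal if $\mu(x+y)\ge\min\{\mu(x),\mu(y)\}$ and $\mu(x\gamma y)\ge\mu(y)$ (resp. $\mu(x\gamma y)\ge\mu(x)$) for all $x,y\in S$, $\gamma\in\Gamma$. It is a fuzzy left (right) $h$-ideal if moreover for all $a,b,x,z\in S$, $x+a+z=b+z$ implies $\mu(x)\ge\min\{\mu(a),\mu(b)\}$. A fuzzy $h$-ideal is one which is both a fuzzy left and a fuzzy right $h$-ideal. The same definitions are used for a hemiring with $xy$ in place of $x\gamma y$. Convention: all fuzzy (left, right) $h$-ideals $\mu$ are assumed to satisfy $\mu(0)=1$. The sets of fuzzy $h$-ideals are ordered by inclusion: $\mu\subseteq\nu$ iff $\mu(x)\le\nu(x)$ for all $x$. **The map.** For a fuzzy subset $\sigma$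 of $S$, $\sigma^{+'}$ is the fuzzy subset of $L$ given by $\sigma^{+'}(\sum_i[x_i,\alpha_i])=\inf_{s\in S}\sigma(\sum_i x_i\alpha_is)$. *)

(* Defs.v *)
From HB Require Import structures.
From mathcomp Require Import all_boot all_order all_algebra finmap multiset.
From mathcomp Require Import generic_quotient.
From mathcomp Require Import boolp classical_sets reals.

Set Implicit Arguments.
Unset Strict Implicit.
Unset Printing Implicit Defensive.

Import Order.TTheory GRing.Theory Num.Theory.

Local Open Scope ring_scope.
Local Open Scope quotient_scope.

HB.mixin Record Nmodule_isGammaHemiring (Gamma : nmodType) S
    of GRing.Nmodule S := {
  gmul : S -> Gamma -> S -> S;
  gmulDl : forall (a b : S) (al : Gamma) (c : S),
    gmul (a + b) al c = gmul a al c + gmul b al c;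
  gmulDr : forall (a : S) (al : Gamma) (b c : S),
    gmul a al (b + c) = gmul a al b + gmul a al c;
  gmulDm : forall (a : S) (al be : Gamma) (b : S),
    gmul a (al + be) b = gmul a al b + gmul a be b;
  gmulA : forall (a : S) (al : Gamma) (b : S) (be : Gamma) (c : S),
    gmul a al (gmul b be c) = gmul (gmul a al b) be c;
  gmul0l : forall (al : Gamma) (a : S), gmul 0 al a = 0;
  gmul0r : forall (a : S) (al : Gamma), gmul a al 0 = 0;
  gmul0m : forall a b : S, gmul a 0 b = 0
}.

#[short(type="gammaHemiringType")]
HB.structure Definition GammaHemiring (Gamma : nmodType) :=
  { S of GRing.Nmodule S & Nmodule_isGammaHemiring Gamma S }.

(* Unlike the library's semirings, a hemiring need not have a unit. *)
HB.mixin Record Nmodule_isHemiring H of GRing.Nmodule H := {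
  hmul : H -> H -> H;
  hmulA : associative hmul;
  hmulDl : left_distributive hmul +%R;
  hmulDr : right_distributive hmul +%R;
  hmul0l : left_zero 0 hmul;
  hmul0r : right_zero 0 hmul
}.

#[short(type="hemiringType")]
HB.structure Definition Hemiring :=
  { H of GRing.Nmodule H & Nmodule_isHemiring H }.

Definition has_left_unity (Gamma : nmodType) (S : gammaHemiringType Gamma) :=
  exists (n : nat) (e : 'I_n -> S) (delta : 'I_n -> Gamma),
    forall a : S, \sum_(i < n) gmul (e i) (delta i) a = a.

Definition has_right_unity (Gamma : nmodType) (S : gammaHemiringType Gamma) :=
  exists (n : nat) (gamma : 'I_n -> Gamma) (f : 'I_n -> S),
    forall a : S, \sum_(j < n) gmul a (gamma j) (f j) = a.

Section LeftOperatorHemiring.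
Variables (Gamma : nmodType) (S : gammaHemiringType Gamma).

(* The free commutative semigroup on S * Gamma: non-empty finite multisets. *)
Definition formal_sum : Type :=
  {m : {mset (S * Gamma)%type}%mset | m != mset0}.
HB.instance Definition _ := Choice.on formal_sum.
Implicit Types f g h : formal_sum.

Fact formal_gen_subproof (p : S * Gamma) : [mset p]%mset != mset0.
Proof. by rewrite -size_mset_eq0 enum_msetn. Qed.

Definition formal_gen (x : S) (al : Gamma) : formal_sum :=
  exist _ [mset (x, al)]%mset (formal_gen_subproof (x, al)).

Fact formal_add_subproof f g : (val f `+` val g)%mset != mset0.
Proof.
apply: contraNneq (valP f) => /msetP fg0; apply/eqP/msetP => p.
by have := fg0 p; rewrite msetE2 !mset0E; case: (val f p).
Qed.

Definition formal_add f g : formal_sum :=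
  exist _ (val f `+` val g)%mset (formal_add_subproof f g).

Definition formal_mul_mset f g : {mset (S * Gamma)%type}%mset :=
  seq_mset [seq (gmul p.1 p.2 q.1, q.2) | p <- val f, q <- val g].

Fact formal_mul_subproof f g : formal_mul_mset f g != mset0.
Proof.
rewrite -size_mset_eq0 (perm_size (perm_eq_seq_mset _)) size_allpairs.
by rewrite muln_eq0 !size_mset_eq0 negb_or (valP f) (valP g).
Qed.

Definition formal_mul f g : formal_sum :=
  exist _ (formal_mul_mset f g) (formal_mul_subproof f g).

Definition formal_eval f (a : S) : S :=
  \sum_(p <- val f) gmul p.1 p.2 a.

Definition formal_rel : rel formal_sum :=
  fun f g => `[< forall a : S, formal_eval f a = formal_eval g a >].

Fact formal_rel_refl : reflexive formal_rel.
Proof. by move=> f; apply/asboolP. Qed.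

Fact formal_rel_sym : symmetric formal_rel.
Proof. by move=> f g; apply/asboolP/asboolP => fg a; rewrite fg. Qed.

Fact formal_rel_trans : transitive formal_rel.
Proof.
by move=> g f h /asboolP fg /asboolP gh; apply/asboolP => a; rewrite fg gh.
Qed.

Canonical formal_rel_equiv :=
  EquivRel formal_rel formal_rel_refl formal_rel_sym formal_rel_trans.

Definition left_operator : Type := {eq_quot formal_rel}.
HB.instance Definition _ := Choice.on left_operator.
HB.instance Definition _ := Quotient.on left_operator.

Implicit Types l m : left_operator.

(* [lclass x al] is the class [x, al]. *)
Definition lclass (x : S) (al : Gamma) : left_operator :=
  \pi_left_operator (formal_gen x al).

Definition lzero : left_operator := lclass 0 0.

(* [pi_formal_add] and [pi_formal_mul] below show that the operations do not
   depend on the representatives. *)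
Definition ladd l m : left_operator :=
  \pi_left_operator (formal_add (repr l) (repr m)).

Definition lmul l m : left_operator :=
  \pi_left_operator (formal_mul (repr l) (repr m)).

(* The element \sum_i x_i alpha_i a for l = \sum_i [x_i, alpha_i]; by [lactE]
   it does not depend on the representative. *)
Definition lact l (a : S) : S := formal_eval (repr l) a.

Lemma lactE f a : lact (\pi_left_operator f) a = formal_eval f a.
Proof.
have /eqmodP/asboolP fE : \pi_left_operator (repr (\pi_left_operator f))
                          = \pi_left_operator f by rewrite reprK.
exact: fE.
Qed.

Lemma lactP l m : lact l =1 lact m -> l = m.
Proof.
by move=> lm; rewrite -[l]reprK -[m]reprK; apply/eqmodP/asboolP.
Qed.

Lemma formal_evalD f g a :
  formal_eval (formal_add f g) a = formal_eval f a + formal_eval g a.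
Proof.
rewrite /formal_eval -big_cat; apply: perm_big; apply/allP => p _ /=.
by rewrite count_cat !count_mem_mset msetE2.
Qed.

Lemma gmul_sumr (I : Type) (r : seq I) (F : I -> S) al (a : S) :
  gmul a al (\sum_(i <- r) F i) = \sum_(i <- r) gmul a al (F i).
Proof.
elim: r => [|i r IHr]; first by rewrite !big_nil gmul0r.
by rewrite !big_cons gmulDr IHr.
Qed.

Lemma formal_evalM f g a :
  formal_eval (formal_mul f g) a = formal_eval f (formal_eval g a).
Proof.
rewrite {1}/formal_eval (perm_big _ (perm_eq_seq_mset _)) /= big_allpairs_dep /=.
apply: eq_bigr => p _; rewrite gmul_sumr; apply: eq_bigr => q _.
by rewrite gmulA.
Qed.

Lemma lact_add l m a : lact (ladd l m) a = lact l a + lact m a.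
Proof. by rewrite lactE formal_evalD. Qed.

Lemma lact_mul l m a : lact (lmul l m) a = lact l (lact m a).
Proof. by rewrite lactE formal_evalM. Qed.

Lemma pi_formal_add f g :
  \pi_left_operator (formal_add f g)
  = ladd (\pi_left_operator f) (\pi_left_operator g).
Proof. by apply: lactP => a; rewrite lact_add !lactE formal_evalD. Qed.

Lemma pi_formal_mul f g :
  \pi_left_operator (formal_mul f g)
  = lmul (\pi_left_operator f) (\pi_left_operator g).
Proof. by apply: lactP => a; rewrite lact_mul !lactE formal_evalM. Qed.

Lemma lact_class x al a : lact (lclass x al) a = gmul x al a.
Proof. by rewrite lactE /formal_eval /= enum_msetn /= big_seq1. Qed.

Lemma lact_zero a : lact lzero a = 0.
Proof. by rewrite lact_class gmul0l. Qed.

Lemma lact0 l : lact l 0 = 0.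
Proof. by apply: big1 => p _; rewrite gmul0r. Qed.

Lemma lactD l a b : lact l (a + b) = lact l a + lact l b.
Proof. by rewrite -big_split; apply: eq_bigr => p _; rewrite gmulDr. Qed.

Lemma lclass0 al : lclass 0 al = lzero.
Proof. by apply: lactP => a; rewrite !lact_class !gmul0l. Qed.

Fact laddA : associative ladd.
Proof. by move=> k l m; apply: lactP => a; rewrite !lact_add addrA. Qed.

Fact laddC : commutative ladd.
Proof. by move=> k l; apply: lactP => a; rewrite !lact_add addrC. Qed.

Fact ladd0 : left_id lzero ladd.
Proof. by move=> k; apply: lactP => a; rewrite lact_add lact_zero add0r. Qed.

HB.instance Definition _ :=
  GRing.isNmodule.Build left_operator laddA laddC ladd0.

Fact lmulA : associative lmul.
Proof. by move=> k l m; apply: lactP => a; rewrite !lact_mul. Qed.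

Fact lmulDl : left_distributive lmul +%R.
Proof.
by move=> k l m; apply: lactP => a; rewrite !(lact_add, lact_mul).
Qed.

Fact lmulDr : right_distributive lmul +%R.
Proof.
by move=> k l m; apply: lactP => a; rewrite !(lact_add, lact_mul) lactD.
Qed.

Fact lmul0l : left_zero 0 lmul.
Proof. by move=> k; apply: lactP => a; rewrite lact_mul !lact_zero. Qed.

Fact lmul0r : right_zero 0 lmul.
Proof. by move=> k; apply: lactP => a; rewrite lact_mul !lact_zero lact0. Qed.

HB.instance Definition _ :=
  Nmodule_isHemiring.Build left_operator lmulA lmulDl lmulDr lmul0l lmul0r.

End LeftOperatorHemiring.

Section FuzzyHIdeals.
Context {R : realType} {V : nmodType} {I : Type}.
(* The products x gamma y (I := Gamma) or the single product x y (I := unit). *)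
Variable mul : I -> V -> V -> V.
Implicit Type mu : V -> R.

Definition fuzzy_subset mu := forall x, 0 <= mu x <= 1.

Definition fuzzy_nonempty mu := exists x, mu x != 0.

Definition fuzzy_left_ideal mu :=
  [/\ fuzzy_subset mu, fuzzy_nonempty mu,
      forall x y, Num.min (mu x) (mu y) <= mu (x + y)
    & forall i x y, mu y <= mu (mul i x y)].

Definition fuzzy_right_ideal mu :=
  [/\ fuzzy_subset mu, fuzzy_nonempty mu,
      forall x y, Num.min (mu x) (mu y) <= mu (x + y)
    & forall i x y, mu x <= mu (mul i x y)].

Definition fuzzy_h_condition mu :=
  forall a b x z, x + a + z = b + z -> Num.min (mu a) (mu b) <= mu x.

Definition fuzzy_left_h_ideal mu := fuzzy_left_ideal mu /\ fuzzy_h_condition mu.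

Definition fuzzy_right_h_ideal mu :=
  fuzzy_right_ideal mu /\ fuzzy_h_condition mu.

Definition fuzzy_h_ideal mu := fuzzy_left_h_ideal mu /\ fuzzy_right_h_ideal mu.

End FuzzyHIdeals.

(* The set of fuzzy h-ideals, under the convention mu 0 = 1. *)
Record fuzzy_h_ideals (R : realType) (V : nmodType) (I : Type)
    (mul : I -> V -> V -> V) := FuzzyHIdeal {
  fhi_fun :> V -> R;
  _ : `[< fuzzy_h_ideal mul fhi_fun /\ fhi_fun 0 = 1 >]
}.

HB.instance Definition _ R V I mul :=
  [isSub for @fhi_fun R V I mul].
HB.instance Definition _ R V I mul :=
  [Choice of @fuzzy_h_ideals R V I mul by <:].

Fact fhi_display : Order.disp_t. Proof. exact: Order.Disp tt tt. Qed.

Section Lattice.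
Context {R : realType} {V : nmodType} {I : Type} {mul : I -> V -> V -> V}.
Local Notation T := (fuzzy_h_ideals R mul).
Implicit Types mu nu th : T.

Lemma fhiP mu : fuzzy_h_ideal mul mu.
Proof. by case: mu => mu /= /asboolP[]. Qed.

Lemma fhi0 mu : mu 0 = 1.
Proof. by case: mu => mu /= /asboolP[]. Qed.

Lemma fhi_ge0 mu x : 0 <= mu x.
Proof. by have [[[/(_ x)/andP[]]]] := fhiP mu. Qed.

Lemma fhi_le1 mu x : mu x <= 1.
Proof. by have [[[/(_ x)/andP[]]]] := fhiP mu. Qed.

Lemma fhiD mu x y : Num.min (mu x) (mu y) <= mu (x + y).
Proof. by have [[[_ _ H _] _] _] := fhiP mu. Qed.

Lemma fhiMl mu i x y : mu y <= mu (mul i x y).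
Proof. by have [[[_ _ _ H] _] _] := fhiP mu. Qed.

Lemma fhiMr mu i x y : mu x <= mu (mul i x y).
Proof. by have [_ [[_ _ _ H] _]] := fhiP mu. Qed.

Lemma fhiH mu a b x z : x + a + z = b + z -> Num.min (mu a) (mu b) <= mu x.
Proof. by have [[_ H] _] := fhiP mu; apply: H. Qed.

Lemma fhi_intro (f : V -> R) :
  (forall x, 0 <= f x <= 1) -> f 0 = 1 ->
  (forall x y, Num.min (f x) (f y) <= f (x + y)) ->
  (forall i x y, f y <= f (mul i x y)) ->
  (forall i x y, f x <= f (mul i x y)) ->
  fuzzy_h_condition f ->
  `[< fuzzy_h_ideal mul f /\ f 0 = 1 >].
Proof.
move=> f01 f0 fD fMl fMr fH; apply/asboolP.
have fN : fuzzy_nonempty f by exists 0; rewrite f0 oner_eq0.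
by split=> //; split; split=> //; split.
Qed.

Definition fhi_le : rel T := fun mu nu => `[< forall x, mu x <= nu x >].

Fact fhi_le_refl : reflexive fhi_le.
Proof. by move=> mu; apply/asboolP. Qed.

Fact fhi_le_anti : antisymmetric fhi_le.
Proof.
move=> mu nu /andP[/asboolP le1 /asboolP le2]; apply: val_inj.
by apply/funext => x; apply/le_anti; rewrite le1 le2.
Qed.

Fact fhi_le_trans : transitive fhi_le.
Proof.
move=> nu mu th /asboolP le1 /asboolP le2; apply/asboolP => x.
exact: le_trans (le1 x) (le2 x).
Qed.

HB.instance Definition _ := Order.Le_isPOrder.Build fhi_display T
  fhi_le_refl fhi_le_anti fhi_le_trans.

Fact fhi_inf_subproof (A : set T) : (A !=set0)%classic ->
  let f x : R := inf [set mu x | mu in A]%classic in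
  is_true `[< fuzzy_h_ideal mul f /\ f 0 = 1 >].
Proof.
move=> [th Ath] f.
have fle x mu : A mu -> f x <= mu x.
  move=> Amu; apply: ge_inf; last by exists mu.
  by exists 0 => _ [nu _ <-]; apply: fhi_ge0.
have lef x r : (forall mu, A mu -> r <= mu x) -> r <= f x.
  move=> rle; apply: lb_le_inf; first by exists (th x); exists th.
  by move=> _ [nu Anu <-]; apply: rle.
apply: fhi_intro.
- move=> x; rewrite lef ?(le_trans (fle x th Ath)) ?fhi_le1 //.
  by move=> mu _; apply: fhi_ge0.
- apply/le_anti; rewrite -{1}(fhi0 th) fle //= lef // => mu _.
  by rewrite fhi0.
- move=> x y; apply: lef => mu Amu; apply: le_trans (fhiD mu x y).
  by rewrite le_min !ge_min !fle // orbT.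
- by move=> i x y; apply: lef => mu Amu; apply: le_trans (fhiMl _ _ _ _); apply: fle.
- by move=> i x y; apply: lef => mu Amu; apply: le_trans (fhiMr _ _ _ _); apply: fle.
- move=> a b x z E; apply: lef => mu Amu; apply: le_trans (fhiH mu E).
  by rewrite le_min !ge_min !fle // orbT.
Qed.

Fact fhi_meet_subproof mu nu :
  let f x : R := Num.min (mu x) (nu x) in
  is_true `[< fuzzy_h_ideal mul f /\ f 0 = 1 >].
Proof.
move=> f.
have mono (a b c d a' b' : R) : Num.min a b <= a' -> Num.min c d <= b' ->
    Num.min (Num.min a c) (Num.min b d) <= Num.min a' b'.
  by rewrite minACA => h1 h2; apply: le_min2.
apply: fhi_intro.
- by move=> x; rewrite /f le_min !fhi_ge0 ge_min fhi_le1.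
- by rewrite /f !fhi0 minxx.
- by move=> x y; apply: mono; apply: fhiD.
- by move=> i x y; apply: le_min2; apply: fhiMl.
- by move=> i x y; apply: le_min2; apply: fhiMr.
- by move=> a b x z E; apply: mono; apply: (fhiH _ E).
Qed.

Definition fhi_meet mu nu : T := FuzzyHIdeal (fhi_meet_subproof mu nu).

Fact fhi_lexI th mu nu :
  (th <= fhi_meet mu nu)%O = (th <= mu)%O && (th <= nu)%O.
Proof.
apply/asboolP/andP => [le|[/asboolP le1 /asboolP le2] x].
  by split; apply/asboolP => x; have /= := le x; rewrite le_min => /andP[].
by rewrite /= le_min le1 le2.
Qed.

HB.instance Definition _ :=
  Order.POrder_isMeetSemilattice.Build fhi_display T fhi_lexI.

Fact fhi_top_subproof :
  `[< fuzzy_h_ideal mul (fun=> 1 : R) /\ (1 : R) = 1 >].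
Proof.
by apply: fhi_intro => [x||x y|//|//|a b x z _]; rewrite ?minxx ?ler01 ?lexx.
Qed.

Definition fhi_top : T := FuzzyHIdeal fhi_top_subproof.

(* The join is the smallest fuzzy h-ideal above both arguments. *)
Definition fhi_upper mu nu : set T :=
  [set th | (mu <= th)%O /\ (nu <= th)%O]%classic.

Fact fhi_upper_nonempty mu nu : (fhi_upper mu nu !=set0)%classic.
Proof. by exists fhi_top; split; apply/asboolP => x; apply: fhi_le1. Qed.

Definition fhi_join mu nu : T :=
  FuzzyHIdeal (fhi_inf_subproof (fhi_upper_nonempty mu nu)).

Fact fhi_leUx mu nu th :
  (fhi_join mu nu <= th)%O = (mu <= th)%O && (nu <= th)%O.
Proof.
have [k Uk] := fhi_upper_nonempty mu nu.
have leJ ka : (forall ta, fhi_upper mu nu ta -> (ka <= ta)%O) ->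
    (ka <= fhi_join mu nu)%O.
  move=> H; apply/asboolP => x; apply: lb_le_inf; first by exists (k x), k.
  by move=> _ [ta Uta <-]; move: (H ta Uta) => /asboolP.
apply/idP/andP => [le|[le1 le2]].
  by split; apply: le_trans le; apply: leJ => ta [].
apply/asboolP => x; apply: ge_inf; last by exists th.
by exists 0 => _ [ta _ <-]; apply: fhi_ge0.
Qed.

HB.instance Definition _ :=
  Order.POrder_isJoinSemilattice.Build fhi_display T fhi_leUx.

End Lattice.

Definition FhI_gamma (R : realType) (Gamma : nmodType)
    (S : gammaHemiringType Gamma) :=
  fuzzy_h_ideals R (fun (gamma : Gamma) (x y : S) => gmul x gamma y).
HB.instance Definition _ R Gamma S := Order.Lattice.on (@FhI_gamma R Gamma S).

Definition FhI (R : realType) (H : hemiringType) :=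
  fuzzy_h_ideals R (fun (_ : unit) (x y : H) => hmul x y).
HB.instance Definition _ R H := Order.Lattice.on (@FhI R H).

(* The map sigma |-> sigma^{+'}; for l = \sum_i [x_i, alpha_i], lact l s is
   \sum_i x_i alpha_i s. *)
Definition fuzzy_plus' (R : realType) (Gamma : nmodType)
    (S : gammaHemiringType Gamma) (sigma : S -> R) : left_operator S -> R :=
  fun l => inf [set sigma (lact l s) | s in [set: S]]%classic.

(* Main.v *)
Require Import Defs.
From mathcomp Require Import all_boot all_order all_algebra.
From mathcomp Require Import boolp classical_sets reals.

(** The inverse of sigma |-> sigma^{+'} is mu |-> mu^+, where mu^+(x) is the
    infimum of mu([x, gamma]) over gamma in Gamma.  Ideals absorb products, so
    mu^+^{+'} >= mu and sigma^{+'}^+ >= sigma.  Conversely, a right unity writes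
    x as \sum_j x gamma_j f_j, and a left unity writes l in L as
    \sum_i l [e_i, delta_i] = \sum_i [l e_i, delta_i]; since a fuzzy ideal takes
    at a sum at least its minimum over the terms, both inequalities are
    equalities.  A bijection monotone in both directions is a lattice
    isomorphism. *)

Set Implicit Arguments.
Unset Strict Implicit.
Unset Printing Implicit Defensive.

Import Order.TTheory GRing.Theory Num.Theory.

Local Open Scope ring_scope.

Section OrderIsomorphism.
Local Open Scope order_scope.

(** The meet of [f x] and [f y] has a preimage under [f]; as [f] reflects the order, that preimage
    lies below [x] and [y], hence below their meet. *)
Lemma mono_bij_meet d d' (T : meetSemilatticeType d)
    (T' : meetSemilatticeType d') (f : T -> T') :
  {mono f : x y / x <= y} -> bijective f -> {morph f : x y / x `&` y}.
Proof.
move=> fmono [g fK gK] x y; apply/le_anti.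
rewrite lexI !fmono leIl leIr -[f x `&` f y]gK fmono lexI -!fmono gK.
by rewrite leIl leIr.
Qed.

Lemma mono_bij_join d d' (T : joinSemilatticeType d)
    (T' : joinSemilatticeType d') (f : T -> T') :
  {mono f : x y / x <= y} -> bijective f -> {morph f : x y / x `|` y}.
Proof.
move=> fmono [g fK gK] x y; apply/le_anti.
rewrite leUx !fmono leUl leUr -[f x `|` f y]gK fmono leUx -!fmono gK.
by rewrite leUl leUr.
Qed.

End OrderIsomorphism.

Section InfRange.
Context {R : realType} {I : Type}.
Implicit Types f : I -> R.

Lemma inf_range_le f i : (forall j, 0 <= f j) -> inf (range f) <= f i.
Proof.
move=> f0; apply: ge_inf; last by exists i.
by exists 0 => _ [j _ <-].
Qed.

(** The point [i0] rules out the empty range, whose infimum is 0 by convention. *)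
Lemma le_inf_range f (i0 : I) r :
  (forall i, r <= f i) -> r <= inf (range f).
Proof.
move=> rf; apply: lb_le_inf; first by exists (f i0), i0.
by move=> _ [i _ <-].
Qed.

End InfRange.

Section FuzzyHIdealInf.
Context {R : realType} {V : nmodType} {I : Type} {mul : I -> V -> V -> V}.
Implicit Types mu : fuzzy_h_ideals R mul.

(** The bound [c <= 1] serves the empty sum, where [mu 0 = 1]. *)
Lemma fhi_sum mu (J : Type) (r : seq J) (F : J -> V) c :
  c <= 1 -> (forall j, c <= mu (F j)) -> c <= mu (\sum_(j <- r) F j).
Proof.
move=> c1 cF; elim/big_ind: _ => // [|x y cx cy]; first by rewrite fhi0.
by apply: le_trans (fhiD mu x y); rewrite le_min cx.
Qed.

Lemma fhi_inf_range_le1 mu (J : Type) (j0 : J) (F : J -> V) :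
  inf (range (fun j => mu (F j))) <= 1.
Proof.
by apply: le_trans (inf_range_le j0 _) (fhi_le1 _ _) => j; apply: fhi_ge0.
Qed.

End FuzzyHIdealInf.

(* Pulling a fuzzy h-ideal back along a family of additive maps and taking the
   infimum produces both sigma^{+'} (family [lact^~ s]) and its inverse (family
   [lclass^~ gamma]); only the absorption laws depend on the family. *)
Lemma fhi_inf_pullback (R : realType) (V W : nmodType) (I I' J : Type)
    (mul : I -> V -> V -> V) (mul' : I' -> W -> W -> W)
    (mu : fuzzy_h_ideals R mul) (j0 : J) (F : J -> W -> V) :
  let f w : R := inf (range (fun j => mu (F j w))) in
  (forall j, F j 0 = 0) ->
  (forall j, {morph F j : x y / x + y}) ->
  (forall i x y j, f y <= mu (F j (mul' i x y))) ->
  (forall i x y j, f x <= mu (F j (mul' i x y))) ->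
  `[< fuzzy_h_ideal mul' f /\ f 0 = 1 >].
Proof.
move=> f F0 FD fMl fMr.
have fle w j : f w <= mu (F j w).
  by apply: (inf_range_le (f := fun j => _)) => k; apply: fhi_ge0.
apply: fhi_intro => [w||x y|i x y|i x y|a b x z E].
- rewrite (fhi_inf_range_le1 mu j0) andbT.
  by apply: le_inf_range => // j; apply: fhi_ge0.
- apply/le_anti; rewrite (fhi_inf_range_le1 mu j0) /=.
  by apply: le_inf_range => // j; rewrite F0 fhi0.
- apply: le_inf_range => // j; rewrite FD; apply: le_trans (fhiD _ _ _).
  by apply: le_min2.
- exact: le_inf_range.
- exact: le_inf_range.
- apply: le_inf_range => // j.
  have Ej : F j x + F j a + F j z = F j b + F j z by rewrite -!FD E.
  by apply: le_trans (fhiH mu Ej); apply: le_min2.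
Qed.

Section Correspondence.
Variables (R : realType) (Gamma : nmodType) (S : gammaHemiringType Gamma).
Local Notation L := (left_operator S).
Implicit Types (sigma : FhI_gamma R S) (mu : FhI R L).

Lemma fhi_lact sigma (l : L) a : sigma a <= sigma (lact l a).
Proof. by apply: fhi_sum => [|p]; [apply: fhi_le1 | apply: fhiMl]. Qed.

Lemma lclassD (x y : S) (al : Gamma) :
  lclass (x + y) al = lclass x al + lclass y al.
Proof. by apply: lactP => a; rewrite lact_add !lact_class gmulDl. Qed.

Lemma lact_sum (J : Type) (r : seq J) (F : J -> L) a :
  lact (\sum_(j <- r) F j) a = \sum_(j <- r) lact (F j) a.
Proof.
apply: (big_morph (fun l : L => lact l a)) => [l m|]; first exact: lact_add.
exact: lact_zero.
Qed.

(** The bridge between products in L, to which absorption by [mu] applies, and the action of L on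
    S. *)
Lemma hmul_lclass (l : L) (x : S) (al : Gamma) :
  hmul l (lclass x al) = lclass (lact l x) al.
Proof.
apply: lactP => a; rewrite lact_mul !lact_class /lact /formal_eval.
(* The relation carried through the two sums is [u = gmul u' al a]. *)
by elim/big_ind2: _ => [|u u' v v' -> ->|p _]; rewrite ?gmul0l ?gmulDl ?gmulA.
Qed.

Fact fuzzy_plus'_subproof sigma :
  `[< fuzzy_h_ideal (fun (_ : unit) (l m : L) => hmul l m)
        (fuzzy_plus' sigma) /\ fuzzy_plus' sigma 0 = 1 >].
Proof.
have fle (l : L) s : fuzzy_plus' sigma l <= sigma (lact l s).
  by apply: (inf_range_le (f := fun s => _)) => t; apply: fhi_ge0.
apply: (@fhi_inf_pullback _ _ _ _ _ _ _ _ sigma 0 (fun s (l : L) => lact l s)).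
- exact: lact_zero.
- by move=> s l m; apply: lact_add.
- move=> _ l m s; rewrite lact_mul; apply: le_trans (fhi_lact _ _ _).
  exact: fle.
(* Right absorption: [lact m s] is itself one of the points over which the infimum at [l] runs. *)
- by move=> _ l m s; rewrite lact_mul; apply: fle.
Qed.

Definition fhi_plus' sigma : FhI R L := FuzzyHIdeal (fuzzy_plus'_subproof sigma).

Definition fuzzy_plus (mu : L -> R) (x : S) : R :=
  inf (range (fun gamma => mu (lclass x gamma))).

Fact fuzzy_plus_subproof mu :
  `[< fuzzy_h_ideal (fun (gamma : Gamma) (x y : S) => gmul x gamma y)
        (fuzzy_plus mu) /\ fuzzy_plus mu 0 = 1 >].
Proof.
have fle x gamma : fuzzy_plus mu x <= mu (lclass x gamma).
  by apply: (inf_range_le (f := fun gamma => _)) => ?; apply: fhi_ge0.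
apply: (@fhi_inf_pullback _ _ _ _ _ _ _ _ mu 0 (fun gamma x => lclass x gamma)).
- exact: lclass0.
- by move=> gamma x y; apply: lclassD.
(* The class [x i y, gamma] factors in L as [x, i] [y, gamma]; the values of [mu] at these factors
   occur in the infima at [x] and [y]. *)
- move=> i x y gamma; rewrite -lact_class -hmul_lclass.
  by apply: le_trans (fhiMl _ tt _ _); apply: fle.
- move=> i x y gamma; rewrite -lact_class -hmul_lclass.
  by apply: le_trans (fhiMr _ tt _ _); apply: fle.
Qed.

Definition fhi_plus mu : FhI_gamma R S := FuzzyHIdeal (fuzzy_plus_subproof mu).

Lemma fhi_plus'_le sigma l s : fhi_plus' sigma l <= sigma (lact l s).
Proof. by apply: (inf_range_le (f := fun s => _)) => ?; apply: fhi_ge0. Qed.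

Lemma fhi_plus_le mu x gamma : fhi_plus mu x <= mu (lclass x gamma).
Proof. by apply: (inf_range_le (f := fun gamma => _)) => ?; apply: fhi_ge0. Qed.

Lemma fhi_plus'_homo : {homo fhi_plus' : sigma tau / (sigma <= tau)%O}.
Proof.
move=> sigma tau /asboolP le_st; apply/asboolP => l.
apply: (le_inf_range (0 : S)) => s; apply: le_trans (le_st _).
exact: fhi_plus'_le.
Qed.

Lemma fhi_plus_homo : {homo fhi_plus : mu nu / (mu <= nu)%O}.
Proof.
move=> mu nu /asboolP le_mn; apply/asboolP => x.
apply: (le_inf_range (0 : Gamma)) => gamma; apply: le_trans (le_mn _).
exact: fhi_plus_le.
Qed.

Lemma fhi_plus'K : has_right_unity S -> cancel fhi_plus' fhi_plus.
Proof.
move=> [n [gamma [f fE]]] sigma; apply/le_anti/andP; split; apply/asboolP => x.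
  (* Each term x gamma_j f_j is [x, gamma_j] applied to f_j, so both infima can be specialised, to
     f_j and to gamma_j. *)
  rewrite -[in leRHS](fE x); apply: fhi_sum => [|j]; first exact: fhi_le1.
  rewrite -lact_class; apply: le_trans (fhi_plus'_le _ _ _).
  exact: fhi_plus_le.
apply: (le_inf_range (0 : Gamma)) => al; apply: (le_inf_range (0 : S)) => s.
by rewrite lact_class; apply: fhiMr.
Qed.

Lemma fhi_plusK : has_left_unity S -> cancel fhi_plus fhi_plus'.
Proof.
move=> [n [e [delta eE]]] mu; apply/le_anti/andP; split; apply/asboolP => l.
  have lE : l = \sum_(i < n) lclass (lact l (e i)) (delta i).
    (* Elements of L are determined by their action: expand [a] by the left unity and pull the sum
       out of the additive map [lact l]. *)
    apply: lactP => a; rewrite lact_sum -{1}(eE a).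
    under [RHS]eq_bigr do rewrite -hmul_lclass lact_mul lact_class.
    by apply: (big_morph (lact l)) => [x y|]; rewrite ?lactD ?lact0.
  rewrite [in leRHS]lE; apply: fhi_sum => [|i]; first exact: fhi_le1.
  apply: le_trans (fhi_plus_le _ _ _); exact: fhi_plus'_le.
apply: (le_inf_range (0 : S)) => s; apply: (le_inf_range (0 : Gamma)) => al.
(* The class [l s, al] is the product l [s, al], so right absorption applies. *)
by rewrite -hmul_lclass; apply: (fhiMr mu tt).
Qed.

End Correspondence.

Theorem theorem3p8 (R : realType) (Gamma : nmodType)
    (S : gammaHemiringType Gamma) :
  has_left_unity S -> has_right_unity S ->
  exists Phi : FhI_gamma R S -> FhI R (left_operator S),
    [/\ forall sigma : FhI_gamma R S, fhi_fun (Phi sigma) = fuzzy_plus' sigma,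
        bijective Phi,
        {mono Phi : sigma tau / (sigma <= tau)%O},
        {morph Phi : sigma tau / Order.meet sigma tau}
      & {morph Phi : sigma tau / Order.join sigma tau}].
Proof.
move=> left1 right1.
have bijPhi : bijective (@fhi_plus' R Gamma S).
  exists (@fhi_plus R Gamma S); first exact: fhi_plus'K.
  exact: fhi_plusK.
have monoPhi : {mono @fhi_plus' R Gamma S : sigma tau / (sigma <= tau)%O}.
  move=> sigma tau; apply/idP/idP; last exact: fhi_plus'_homo.
  (* The order is reflected because the inverse map is monotone too. *)
  by move=> /fhi_plus_homo; rewrite !fhi_plus'K.
exists (@fhi_plus' R Gamma S); split=> //.
- exact: mono_bij_meet.
- exact: mono_bij_join.
Qed.
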